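(* Let $G$ and $H$ be finite, simple, undirected, connected graphs, each having a universal vertex. Then ${\rm dmg}(G\square H)\le \min\{|V(G)|,|V(H)|\}$.
   Context: A universal vertex is a vertex adjacent to all other vertices. The Cartesian product $G\square H$ has vertex set $V(G)\times V(H)$, with $(u,v)\sim(u',v')$ iff ($u=u'$ and $vv'\in E(H)$) or ($v=v'$ and $uu'\in E(G)$). Damage game on a graph: one cop and one robber; in round $0$ the cop chooses a vertex, then the robber does; in each later round the cop moves to an adjacent vertex or passes, then the robber moves to an adjacent vertex or passes; the robber is captured if the cop occupies the robber's vertex. A vertex $v$ is damaged if the robber occupies $v$ in some round $i\ge0$ and in round $i+1$ the uncaptured robber passes or moves to a neighbour. The damage number ${\rm dmg}(\cdot)$ is the number of distinct vertices damaged when the cop plays to minimize and the robber to maximize this number. *)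

(* Defs.v *)
From mathcomp Require Import all_boot.
From mathcomp Require Import boolp.

Set Implicit Arguments.
Unset Strict Implicit.
Unset Printing Implicit Defensive.

Record sgraph := SGraph {
  vertex :> finType;
  adj : rel vertex;
  adj_sym : symmetric adj;
  adj_irrefl : irreflexive adj }.

Definition connected (G : sgraph) : Prop :=
  forall x y : G, connect (@adj G) x y.

Definition universal (G : sgraph) (u : G) : Prop :=
  forall v : G, v != u -> adj u v.

Section CartesianProduct.
Variables G H : sgraph.

Definition cart_adj : rel (G * H) := fun x y =>
  ((x.1 == y.1) && adj x.2 y.2) || ((x.2 == y.2) && adj x.1 y.1).

Lemma cart_adj_sym : symmetric cart_adj.
Proof.
move=> x y; rewrite /cart_adj (eq_sym x.1) (eq_sym x.2).
by rewrite (adj_sym x.1) (adj_sym x.2).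
Qed.

Lemma cart_adj_irrefl : irreflexive cart_adj.
Proof. by move=> x; rewrite /cart_adj !adj_irrefl !andbF. Qed.

Definition cartesian_product : sgraph := SGraph cart_adj_sym cart_adj_irrefl.

End CartesianProduct.

Section DamageGame.
Variable G : sgraph.

Definition step (x y : G) : bool := (x == y) || adj x y.

(* A position (c, r) records the vertices of the cop and of the robber at the
   end of a round. In all strategies, the argument of type seq (G * G) lists
   the positions of the rounds preceding the current one, latest first. *)
Record cop_strategy := CopStrategy {
  cop_start : G;
  cop_move : seq (G * G) -> G * G -> G;
  cop_legal : forall h p, step p.1 (cop_move h p) }.

(* robber_start c answers the cop's initial vertex c; robber_move h p c
   answers the move of the cop from p.1 to c. *)
Record robber_strategy := RobberStrategy {
  robber_start : G -> G;
  robber_move : seq (G * G) -> G * G -> G -> G;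
  robber_legal : forall h p c, step p.2 (robber_move h p c) }.

Section Play.
Variables (s : cop_strategy) (t : robber_strategy).

Fixpoint play (n : nat) : seq (G * G) * (G * G) :=
  if n is m.+1 then
    let: (h, p) := play m in
    let c := cop_move s h p in
    (p :: h, (c, robber_move t h p c))
  else ([::], (cop_start s, robber_start t (cop_start s))).

Definition cop_at (n : nat) : G := (play n).2.1.
Definition robber_at (n : nat) : G := (play n).2.2.

(* The robber is still free when he is about to move in round n.+1: he was
   not caught at the end of a round j <= n (first conjunct), nor by the move
   of the cop in a round j.+1 <= n.+1 (second conjunct). The function play is
   also defined after a capture, but those rounds are discarded here. *)
Definition uncaptured (n : nat) : Prop :=
  forall j, j <= n ->
    cop_at j <> robber_at j /\ cop_at j.+1 <> robber_at j.

Definition damaged : {set G} :=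
  [set v | `[< exists n, robber_at n = v /\ uncaptured n >]].

End Play.

(* The maximum and the minimum below range over the values bounded by #|G|,
   which covers all possible cardinals of damaged sets; the default value of
   the minimum is only reached on the empty graph, where the cop has no
   strategy. *)
Definition max_damage (s : cop_strategy) : nat :=
  \max_(k < #|G|.+1 | `[< exists t, #|damaged s t| = k >]) k.

Definition dmg : nat :=
  \big[minn/#|G|]_(k < #|G|.+1 | `[< exists s, max_damage s = k >]) k.

End DamageGame.

(* Main.v *)
(** The cop plays from a copy of [G] at a universal vertex [w] of [H] and follows
    the [G]-coordinate of the robber, capturing him whenever possible. After each
    move of the cop, the robber is adjacent to him or caught, and he remains so if
    he passes or changes his [H]-coordinate. A surviving robber therefore never
    changes his [H]-coordinate and damages at most [#|G|] vertices; exchanging the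
    two factors gives the other bound. *)
Require Import Defs.
From mathcomp Require Import all_boot.
From mathcomp Require Import boolp.

Set Implicit Arguments.
Unset Strict Implicit.
Unset Printing Implicit Defensive.

Lemma bigmin_leq (I : finType) (P : pred I) (F : I -> nat) (m : nat) (i : I) :
  P i -> \big[minn/m]_(j | P j) F j <= F i.
Proof.
move=> Pi; have: i \in index_enum I by rewrite mem_index_enum.
elim: (index_enum I) => // j r IHr; rewrite inE big_cons.
case/predU1P => [<-|/IHr le_r]; first by rewrite Pi geq_minl.
by case: ifP => // _; rewrite geq_min le_r orbT.
Qed.

(** The maximum [max_damage s] never exceeds [#|K|], so it is itself an index of the minimum that
    defines [dmg K]. *)
Lemma dmg_le_strategy (K : sgraph) (s : cop_strategy K) (m : nat) :
  (forall t, #|damaged s t| <= m) -> dmg K <= m.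
Proof.
move=> le_m.
have max_m : max_damage s <= m by apply/bigmax_leqP => k /asboolP [t <-].
have max_K : max_damage s < #|K|.+1.
  by apply/bigmax_leqP => k _; rewrite -ltnS.
apply: leq_trans max_m; rewrite /dmg.
by apply: (@bigmin_leq _ _ _ _ (Ordinal max_K)); apply/asboolP; exists s.
Qed.

Section ShadowStrategy.
(** [shadow x] is where the cop wants to stand when the robber is at [x]. By [step_catch], a robber
    who leaves his level comes within reach of a cop standing there. *)
Variables (K : sgraph) (B : eqType) (c0 : K) (shadow : K -> K) (level : K -> B).
Hypothesis step_start : forall x, step c0 (shadow x).
Hypothesis step_shadow :
  forall x y, step x y -> step (shadow x) (shadow y).
Hypothesis step_catch :
  forall x y, step x y -> level x != level y -> step (shadow x) y.

(* The last branch only makes the strategy legal: it is never used while the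
   robber is free. *)
Definition shadow_move (_ : seq (K * K)) (p : K * K) : K :=
  if step p.1 p.2 then p.2
  else if step p.1 (shadow p.2) then shadow p.2 else p.1.

Lemma shadow_legal h p : step p.1 (shadow_move h p).
Proof.
rewrite /shadow_move; case: ifP => // _; case: ifP => // _.
by rewrite /step eqxx.
Qed.

Definition shadow_strategy : cop_strategy K := CopStrategy c0 shadow_legal.

Variable t : robber_strategy K.
Local Notation s := shadow_strategy.

Lemma shadow_cop_atS n :
  cop_at s t n.+1 = shadow_move [::] (cop_at s t n, robber_at s t n).
Proof. by rewrite /cop_at /robber_at /=; case: (play s t n) => h []. Qed.

Lemma step_robber_at n : step (robber_at s t n) (robber_at s t n.+1).
Proof.
rewrite /robber_at /=; case: (play s t n) => h p /=.
exact: robber_legal.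
Qed.

(** Being free in round [n] also excludes capture by the next cop move, and the cop takes any robber
    within reach. *)
Lemma uncaptured_not_step n :
  uncaptured s t n -> ~~ step (cop_at s t n) (robber_at s t n).
Proof.
move=> /(_ n (leqnn n)) [_ free]; apply/negP => near_robber.
by apply: free; rewrite shadow_cop_atS /shadow_move /= near_robber.
Qed.

Lemma shadow_invariant n : uncaptured s t n ->
  cop_at s t n.+1 = shadow (robber_at s t n) /\
  level (robber_at s t n) = level (robber_at s t 0).
Proof.
elim: n => [|n IHn] free; have far := uncaptured_not_step free.
  by rewrite shadow_cop_atS /shadow_move (negPf far) step_start.
have [|copE levelE] := IHn; first by move=> j /leqW; apply: free.
rewrite shadow_cop_atS /shadow_move (negPf far) /=.
rewrite copE step_shadow ?step_robber_at //; split=> //.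
(* A change of level would bring the robber next to the cop, who has just reached the shadow of his
   previous vertex, against [far]. *)
apply/eqP; rewrite -levelE eq_sym; apply: contraNT far => neq_level.
by rewrite copE step_catch ?step_robber_at.
Qed.

Lemma card_damaged_shadow :
  #|damaged s t| <= #|[set x | level x == level (robber_at s t 0)]|.
Proof.
apply/subset_leq_card/subsetP => x; rewrite !inE => /asboolP [n [<- free]].
by have [_ ->] := shadow_invariant free.
Qed.

End ShadowStrategy.

(** The bound [m] is uniform in the level because the robber chooses the level he starts on. *)
Lemma dmg_le_level (K : sgraph) (B : eqType) (c0 : K) (shadow : K -> K)
    (level : K -> B) (m : nat) :
  (forall x, step c0 (shadow x)) ->
  (forall x y, step x y -> step (shadow x) (shadow y)) ->
  (forall x y, step x y -> level x != level y -> step (shadow x) y) ->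
  (forall b, #|[set x | level x == b]| <= m) ->
  dmg K <= m.
Proof.
move=> start_ok shadow_ok catch_ok card_ok.
apply: (@dmg_le_strategy _ (shadow_strategy c0 shadow)) => t.
exact: leq_trans (card_damaged_shadow start_ok shadow_ok catch_ok t) _.
Qed.

Lemma step_universal (G : sgraph) (u v : G) : universal u -> step u v.
Proof. by move=> univ; rewrite /step eq_sym; case: eqVneq => // /univ. Qed.

(** With [step] in both factors, a pass satisfies both disjuncts and needs no separate case. *)
Lemma step_cartesian (G H : sgraph) (x y : cartesian_product G H) :
  step x y = (x.1 == y.1) && step x.2 y.2 || (x.2 == y.2) && step x.1 y.1.
Proof.
case: x y => [a b] [a' b']; rewrite /step /= /cart_adj xpair_eqE /=.
by case: eqP; case: eqP; rewrite ?orbT ?orbF.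
Qed.

Lemma dmg_cartesian_le_left (G H : sgraph) (u : G) (w : H) :
  universal u -> universal w -> dmg (cartesian_product G H) <= #|G|.
Proof.
move=> univ_u univ_w.
apply: (@dmg_le_level (cartesian_product G H) _
          (u, w) (fun x => (x.1, w)) snd) => [x|x y|x y|b].
- by rewrite step_cartesian /= eqxx (step_universal x.1 univ_u) orbT.
- rewrite !step_cartesian /= eqxx /= => /orP[/andP[/eqP-> _]|/andP[_ ->]].
    by rewrite /step !eqxx.
  by rewrite orbT.
(* A move that changes the second coordinate fixes the first, and [w] reaches every [y.2]. *)
- rewrite !step_cartesian /= (step_universal y.2 univ_w) andbT.
  by case/orP=> /andP[/eqP-> _]; rewrite eqxx.
- have -> : [set x : G * H | x.2 == b] = setX setT [set b].
    by apply/setP => x; rewrite !inE.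
  by rewrite cardsX cards1 cardsT muln1.
Qed.

Lemma dmg_cartesian_le_right (G H : sgraph) (u : G) (w : H) :
  universal u -> universal w -> dmg (cartesian_product G H) <= #|H|.
Proof.
move=> univ_u univ_w.
(* The coordinates swap roles: the cop shadows inside the copy of [H] at [u], and the levels are
   copies of [H]. *)
apply: (@dmg_le_level (cartesian_product G H) _
          (u, w) (fun x => (u, x.2)) fst) => [x|x y|x y|a].
- by rewrite step_cartesian /= eqxx (step_universal x.2 univ_w).
- rewrite !step_cartesian /= eqxx /= => /orP[/andP[_ ->]|/andP[/eqP-> _]] //.
  by rewrite /step !eqxx.
- rewrite !step_cartesian /= (step_universal y.1 univ_u) andbT.
  by case/orP=> /andP[/eqP-> _]; rewrite eqxx ?orbT.
- have -> : [set x : G * H | x.1 == a] = setX [set a] setT.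
    by apply/setP => x; rewrite !inE andbT.
  by rewrite cardsX cards1 cardsT mul1n.
Qed.

Theorem theorem8 (G H : sgraph)
  (G_connected : connected G) (H_connected : connected H)
  (G_universal : exists u : G, universal u)
  (H_universal : exists u : H, universal u) :
  dmg (cartesian_product G H) <= minn #|G| #|H|.
Proof.
have [u univ_u] := G_universal; have [w univ_w] := H_universal.
rewrite leq_min (dmg_cartesian_le_left univ_u univ_w).
exact: dmg_cartesian_le_right univ_u univ_w.
Qed.
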